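(* Let $X$ be a metrizable uniform space and let $d$ be a metric of diameter at most $\pi$ inducing the uniformity of $X$. Then the Euclidean cone over $X$ (defined using $d$) is uniformly homeomorphic to the cone $CX$ keeping $X$ fixed, i.e. by a uniform homeomorphism sending the class of $(x,1)$ in the Euclidean cone to the class of $(x,0)$ in $CX$ for each $x\in X$.
   Context: The Euclidean cone over $X$ is the set $X\times[0,1]/X\times\{0\}$ with the metric $d_E$ given by $$d_E([(x,t)],[(y,s)])^2=t^2+s^2-2ts\cos d(x,y).$$ In it, $X$ is identified with $X\times\{1\}$. The cone $CX$ is $X\times[0,1]/X\times\{1\}$ with the quotient uniformity, i.e. the finest pre-uniformity making the quotient map $X\times[0,1]\to X\times[0,1]/X\times\{1\}$ uniformly continuous; in it, $X$ is identified with $X\times\{0\}$. *)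

(* Defs.v *)
From HB Require Import structures.
From mathcomp Require Import all_boot all_order all_algebra.
From mathcomp Require Import generic_quotient.
From mathcomp Require Import all_classical all_reals all_analysis.
From mathcomp Require Import ring lra.

Set Implicit Arguments.
Unset Strict Implicit.
Unset Printing Implicit Defensive.

Import Order.TTheory GRing.Theory Num.Theory.
Import numFieldNormedType.Exports.

Local Open Scope classical_set_scope.
Local Open Scope ring_scope.
Local Open Scope quotient_scope.

Definition unif_homeomorphism (U V : uniformType) (h : U -> V) : Prop :=
  exists g : V -> U,
    [/\ cancel h g, cancel g h, unif_continuous h & unif_continuous g].

(* The finest uniformity on Q making \pi_Q uniformly continuous: a set is an
   entourage of it when it is an entourage of some uniformity making \pi_Q
   uniformly continuous. A [uniformType] need not be Hausdorff, so it is a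
   pre-uniform space. *)
Definition quotient_uniformity (T : Type) (Q : quotType T) : Type := Q.

Section quotient_uniformity.
Local Open Scope relation_scope.
Variables (T : uniformType) (Q0 : quotType T).

Local Notation Q := (quotient_uniformity Q0).

HB.instance Definition _ := Quotient.copy Q Q0.
HB.instance Definition _ := [Sub Q of T by %/].
HB.instance Definition _ := [Choice of Q by <:].

Definition quotient_ent : set_system (Q * Q) :=
  [set E : set (Q * Q) | exists u : Uniform Q,
    unif_continuous (\pi_Q : T -> Uniform.Pack u) /\
    @entourage (Uniform.Pack u) E].

Let quotient_ent_filter : Filter quotient_ent.
Proof.
split.
- pose U : uniformType := initial_topology (fun _ : Q => false).
  exists (Uniform.class U); split; last exact: (@entourageT U).
  move=> E [B entB BE]; apply: (filterS _ (@entourageT T)) => xy _ /=.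
  by apply: BE; exact: entourage_refl.
- move=> E F [u [cu uE]] [v [cv vF]].
  pose Z : uniformType := (Uniform.Pack u * Uniform.Pack v)%type.
  pose d (x : Q) : Z := (x, x).
  pose U : uniformType := initial_topology d.
  have prodI (A B : set (Q * Q)) : @entourage (Uniform.Pack u) A ->
      @entourage (Uniform.Pack v) B -> @entourage U (A `&` B).
    move=> uA vB; exists [set xy | A (xy.1.1, xy.2.1) /\ B (xy.1.2, xy.2.2)].
      exists (A, B) => //= -[[a1 b1] [a2 b2]] [/= Aa Bb].
      by exists ((a1, a2), (b1, b2)).
    by case.
  exists (Uniform.class U); split; last exact: prodI.
  move=> A [W [[B C] [/= uB vC] BCW] WA]; rewrite nbhs_filterE.
  have entF : Filter (@entourage T) by exact: entourage_filter.
  apply: filterS (filterI (cu _ uB) (cv _ vC)) => -[x y] [/= Bxy Cxy].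
  have [[[a b] [c e]] /= Wabce [ax cy bx ey]] :=
    BCW ((x, y), (x, y)) (conj Bxy Cxy).
  by subst a b c e; exact: WA.
- move=> E F EF [u [cu uE]]; exists u; split=> //.
  exact: (@filterS _ (@entourage (Uniform.Pack u)) _ E).
Qed.

Let quotient_ent_diagonal E : quotient_ent E -> diagonal `<=` E.
Proof.
move=> [u [_ uE]] [x y] /diagonalP ->.
exact: (@entourage_refl (Uniform.Pack u)).
Qed.

Let quotient_ent_inv E : quotient_ent E -> quotient_ent E^-1.
Proof. by move=> [u [cu uE]]; exists u; split. Qed.

Let quotient_ent_split E :
  quotient_ent E -> exists2 F, quotient_ent F & F \; F `<=` E.
Proof.
move=> [u [cu uE]].
have [F uF FE] := @entourage_split_ex (Uniform.Pack u) E uE.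
by exists F => //; exists u.
Qed.

HB.instance Definition _ := isUniform.Build Q
  quotient_ent_filter quotient_ent_diagonal quotient_ent_inv quotient_ent_split.

Lemma pi_unif_continuous : unif_continuous (\pi_Q : T -> Q).
Proof. by move=> E [u [cu /cu]]. Qed.

Lemma quotient_uniformity_finest (u : Uniform Q) :
  unif_continuous (\pi_Q : T -> Uniform.Pack u) ->
  @entourage (Uniform.Pack u) `<=` @entourage Q.
Proof. by move=> cu E uE; exists u. Qed.

Lemma quotient_unif_continuous (V : uniformType) (f : Q -> V) :
  unif_continuous (f \o \pi_Q) -> unif_continuous f.
Proof.
move=> cf E entE; pose U : uniformType := initial_topology f.
exists (Uniform.class U); split; last by exists E.
move=> A [B entB BA]; rewrite nbhs_filterE.
have entF : Filter (@entourage T) by exact: entourage_filter.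
apply: (@filterS _ _ entF _ _ _ (cf _ entB)) => xy Bxy.
exact: (BA (\pi_Q xy.1, \pi_Q xy.2)).
Qed.

End quotient_uniformity.

Section collapse.
Variables (X I : choiceType) (t : I).

Let collapse_rel' (p q : X * I) :=
  (p == q) || ((p.2 == t) && (q.2 == t)).

Let collapse_refl : reflexive collapse_rel'.
Proof. by move=> p; rewrite /collapse_rel' eqxx. Qed.

Let collapse_sym : symmetric collapse_rel'.
Proof. by move=> p q; rewrite /collapse_rel' eq_sym andbC. Qed.

Let collapse_trans : transitive collapse_rel'.
Proof.
move=> q p r /predU1P[-> //|] + /predU1P[<- //|]; rewrite /collapse_rel'.
by move=> /andP[-> _] /andP[_ ->]; rewrite orbT.
Qed.

Definition collapse_rel :=
  EquivRel collapse_rel' collapse_refl collapse_sym collapse_trans.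

(* X * I / X * {t} *)
Definition collapse := {eq_quot collapse_rel}.

HB.instance Definition _ := Choice.on collapse.
HB.instance Definition _ := Quotient.on collapse.

Lemma collapseP (p q : X * I) :
  \pi_collapse p = \pi_collapse q <-> p = q \/ (p.2 = t /\ q.2 = t).
Proof.
split=> [/eqmodP/orP[/eqP|/andP[/eqP ? /eqP ?]]|]; [by left|by right|].
case=> [->//|[pt qt]]; apply/eqmodP/orP.
by right; rewrite pt qt eqxx.
Qed.

End collapse.
Arguments collapse X {I} t.

Definition unit_itv (R : realType) : set R := `[0, 1].
Arguments unit_itv R : clear implicits.

Section unit_itv_endpoints.
Variable R : realType.

Let itv0 : (0 : R) \in unit_itv R.
Proof. by rewrite inE /unit_itv /= in_itv /= lexx ler01. Qed.

Let itv1 : (1 : R) \in unit_itv R.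
Proof. by rewrite inE /unit_itv /= in_itv /= lexx ler01. Qed.

Definition unit_itv0 : unit_itv R := exist _ 0 itv0.
Definition unit_itv1 : unit_itv R := exist _ 1 itv1.

End unit_itv_endpoints.
Arguments unit_itv0 {R}.
Arguments unit_itv1 {R}.

Definition cone (R : realType) (X : uniformType) :=
  quotient_uniformity (collapse X (@unit_itv1 R)).

HB.instance Definition _ R X := Uniform.on (@cone R X).

Section euclidean_distance.
Variable R : realType.
Implicit Types t s r a b c : R.

Definition euclidean_dist t s a : R :=
  Num.sqrt (t ^+ 2 + s ^+ 2 - 2 * t * s * cos a).

Let sum_sqr t s a : t ^+ 2 + s ^+ 2 - 2 * t * s * cos a =
  (t * cos a - s) ^+ 2 + (t * sin a) ^+ 2.
Proof. by have := cos2Dsin2 a; nra. Qed.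

Lemma euclidean_dist_sqr t s a :
  euclidean_dist t s a ^+ 2 = t ^+ 2 + s ^+ 2 - 2 * t * s * cos a.
Proof. by rewrite sqr_sqrtr// sum_sqr addr_ge0// sqr_ge0. Qed.

Lemma euclidean_dist_ge0 t s a : 0 <= euclidean_dist t s a.
Proof. exact: sqrtr_ge0. Qed.

Lemma euclidean_distC t s a : euclidean_dist t s a = euclidean_dist s t a.
Proof. by congr Num.sqrt; ring. Qed.

Lemma euclidean_dist0l s a b : euclidean_dist 0 s a = euclidean_dist 0 s b.
Proof. by congr Num.sqrt; ring. Qed.

Lemma euclidean_dist_angle t s a b : 0 <= t -> 0 <= s ->
  0 <= a -> a <= b -> b <= pi -> euclidean_dist t s a <= euclidean_dist t s b.
Proof.
move=> t0 s0 a0 ab bpi; apply: ler_wsqrtr; rewrite lerD2l lerN2.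
rewrite ler_wpM2l ?mulr_ge0//.
move: ab; rewrite le_eqVlt => /predU1P[->//|ab].
by apply/ltW; rewrite ltr_cos// in_itv/= ?a0 ?bpi ?andbT ?(le_trans a0 (ltW ab))//
  (le_trans (ltW ab)).
Qed.

Let minkowski (u1 u2 v1 v2 : R) :
  Num.sqrt ((u1 + v1) ^+ 2 + (u2 + v2) ^+ 2) <=
  Num.sqrt (u1 ^+ 2 + u2 ^+ 2) + Num.sqrt (v1 ^+ 2 + v2 ^+ 2).
Proof.
set A := Num.sqrt (u1 ^+ 2 + _); set B := Num.sqrt (v1 ^+ 2 + _).
have A0 : 0 <= A by exact: sqrtr_ge0.
have B0 : 0 <= B by exact: sqrtr_ge0.
have A2 : A ^+ 2 = u1 ^+ 2 + u2 ^+ 2 by rewrite sqr_sqrtr// addr_ge0// sqr_ge0.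
have B2 : B ^+ 2 = v1 ^+ 2 + v2 ^+ 2 by rewrite sqr_sqrtr// addr_ge0// sqr_ge0.
rewrite -(@ger0_norm _ (A + B)) ?addr_ge0// -sqrtr_sqr; apply: ler_wsqrtr.
suff : u1 * v1 + u2 * v2 <= A * B by nra.
apply: le_trans (ler_norm _) _.
rewrite -(@ger0_norm _ (A * B)) ?mulr_ge0// -!sqrtr_sqr; apply: ler_wsqrtr.
rewrite exprMn A2 B2.
by have := sqr_ge0 (u1 * v2 - u2 * v1); nra.
Qed.

Lemma euclidean_dist_triangle t s r a b c : 0 <= t -> 0 <= s -> 0 <= r ->
  0 <= a <= pi -> 0 <= b <= pi -> 0 <= c <= pi -> c <= a + b ->
  euclidean_dist t r c <= euclidean_dist t s a + euclidean_dist s r b.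
Proof.
move=> t0 s0 r0 /andP[a0 api] /andP[b0 bpi] /andP[c0 cpi] cab.
have [b' [b'0 b'b cab' ab'pi]] :
    exists b', [/\ 0 <= b', b' <= b, c <= a + b' & a + b' <= pi].
  have [abpi|/ltW abpi] := leP (a + b) pi; first by exists b.
  by exists (pi - a); split; lra.
apply: (@le_trans _ _ (euclidean_dist t r (a + b'))).
  exact: euclidean_dist_angle.
apply: (@le_trans _ _ (euclidean_dist t s a + euclidean_dist s r b')); last first.
  by rewrite lerD2l euclidean_dist_angle.
rewrite (euclidean_distC s r) /euclidean_dist !sum_sqr.
have -> : (t * cos (a + b') - r) ^+ 2 + (t * sin (a + b')) ^+ 2 =
    ((t * cos a - s) + (s - r * cos b')) ^+ 2 +
    (t * sin a + r * sin b') ^+ 2.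
  rewrite -sum_sqr cosD.
  have := cos2Dsin2 a; have := cos2Dsin2 b'; nra.
apply: le_trans (minkowski _ _ _ _) _.
rewrite lerD2l; apply: ler_wsqrtr.
by rewrite le_eqVlt; apply/orP; left; apply/eqP; ring.
Qed.

Lemma euclidean_dist_eq0 t s a : 0 <= t -> 0 <= s -> 0 <= a <= pi ->
  euclidean_dist t s a = 0 -> t = s /\ (t = 0 \/ a = 0).
Proof.
move=> t0 s0 /andP[a0 api] d0; have := euclidean_dist_sqr t s a.
rewrite d0 expr0n /= => /esym E.
have c1 := cos_le1 a.
have ts1 : 0 <= t * s * (1 - cos a) by rewrite !mulr_ge0// subr_ge0.
have ts : t = s.
  have : (t - s) ^+ 2 <= 0 by nra.
  by rewrite exprn_even_le0//= subr_eq0 => /eqP.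
split=> //; subst s.
have : t * t * (1 - cos a) == 0 by apply/eqP; nra.
rewrite !mulf_eq0 orbb subr_eq0 => /orP[/eqP|/eqP ca]; [by left|right].
apply: (@cos_inj R); rewrite ?in_itv/= ?a0//.
  by rewrite lexx pi_ge0.
by rewrite cos0.
Qed.

End euclidean_distance.

(* Without [diamX] the distance below need not satisfy the triangle
   inequality. *)
Definition euclidean_cone (R : realType) (X : metricType R)
  (diamX : forall x y : X, mdist x y <= pi) : Type := collapse X (@unit_itv0 R).

Section euclidean_cone.
Variables (R : realType) (X : metricType R).
Variable diamX : forall x y : X, mdist x y <= pi.

Local Notation E := (euclidean_cone diamX).

HB.instance Definition _ := Choice.copy E (collapse X (@unit_itv0 R)).
HB.instance Definition _ := Quotient.copy E (collapse X (@unit_itv0 R)).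

Definition prod_dist (p q : X * unit_itv R) : R :=
  euclidean_dist (val p.2) (val q.2) (mdist p.1 q.1).

Definition euclidean_cone_dist (p q : E) : R := prod_dist (repr p) (repr q).

Let val_ge0 (t : unit_itv R) : 0 <= val t.
Proof. by have := valP t; rewrite inE /unit_itv /= in_itv /= => /andP[]. Qed.

Let angle (x y : X) : 0 <= mdist x y <= pi.
Proof. by rewrite mdist_ge0 diamX. Qed.

Let prod_distC p q : prod_dist p q = prod_dist q p.
Proof. by rewrite /prod_dist euclidean_distC metric_sym. Qed.

Let prod_dist_pi p p' q : \pi_E p = \pi_E p' -> prod_dist p q = prod_dist p' q.
Proof.
move=> /collapseP[->//|[p0 p'0]].
by rewrite /prod_dist p0 p'0; exact: euclidean_dist0l.
Qed.

Lemma euclidean_cone_distE (p q : X * unit_itv R) :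
  euclidean_cone_dist (\pi_E p) (\pi_E q) = prod_dist p q.
Proof.
rewrite /euclidean_cone_dist (@prod_dist_pi _ p) ?reprK//.
by rewrite prod_distC (@prod_dist_pi _ q) ?reprK// prod_distC.
Qed.

Let dist_xx p : euclidean_cone_dist p p = 0.
Proof.
rewrite /euclidean_cone_dist /prod_dist mdistxx; apply/eqP.
by rewrite -sqrf_eq0 euclidean_dist_sqr cos0; apply/eqP; ring.
Qed.

Let dist_positivity p q : euclidean_cone_dist p q = 0 -> p = q.
Proof.
move=> /(euclidean_dist_eq0 (val_ge0 _) (val_ge0 _) (angle _ _)) [ts h].
rewrite -[p]reprK -[q]reprK; apply/collapseP.
move: h ts; case: (repr p) => x t; case: (repr q) => y s /=.
move=> [t0 ts|/mdist_positivity -> /val_inj ->]; [right|by left].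
by split; apply: val_inj; rewrite /= -?ts t0.
Qed.

Let dist_sym p q : euclidean_cone_dist p q = euclidean_cone_dist q p.
Proof. exact: prod_distC. Qed.

Let dist_triangle q p r : euclidean_cone_dist p r <=
  euclidean_cone_dist p q + euclidean_cone_dist q r.
Proof.
by apply: euclidean_dist_triangle;
  [exact: val_ge0|exact: val_ge0|exact: val_ge0|
   exact: angle|exact: angle|exact: angle|exact: metric_triangle].
Qed.

HB.instance Definition _ := isMetric.Build R E
  dist_xx dist_positivity dist_sym dist_triangle.

Lemma mdist_euclidean_coneE (x y : X) (t s : unit_itv R) :
  mdist (\pi_E (x, t)) (\pi_E (y, s)) ^+ 2 =
  val t ^+ 2 + val s ^+ 2 - 2 * val t * val s * cos (mdist x y).
Proof.
have -> : mdist (\pi_E (x, t)) (\pi_E (y, s)) = prod_dist (x, t) (y, s).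
  exact: euclidean_cone_distE.
exact: euclidean_dist_sqr.
Qed.

End euclidean_cone.

(* Main.v *)
Require Import Defs.
From mathcomp Require Import all_boot all_order all_algebra.
From mathcomp Require Import generic_quotient.
From mathcomp Require Import all_classical all_reals all_analysis.
From mathcomp Require Import ring lra.
Import Order.TTheory GRing.Theory Num.Theory.
Import numFieldNormedType.Exports.
Local Open Scope ring_scope.
Local Open Scope quotient_scope.

(** The homeomorphism reverses the cone parameter: it sends the class of (x,t)
    in the Euclidean cone to the class of (x,1-t) in CX, and it respects the
    two collapsed levels because 1 - t exchanges 0 and 1.

    By the half-angle form of the law of cosines,
      d_E([x,t],[y,s])^2 = (t - s)^2 + 2ts(1 - cos d(x,y)),
    and on [0,pi] the quantities a and 1 - cos a are small together
    ([one_minus_cos_small], [angle_small]).  Hence: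

    - From CX to the Euclidean cone: since CX carries the quotient uniformity,
      it suffices that (x,t) |-> [x,1-t] is uniformly continuous on X x [0,1].
      This holds because the right-hand side is at most
      (t - s)^2 + 2(1 - cos d(x,y)) ([cone_to_euclidean_unif_continuous]).

    - From the Euclidean cone to CX: pull an entourage of CX back to
      X x [0,1], where it contains all pairs closer than some e.  Two points
      at small Euclidean distance have close parameters t and s.  If one of
      the parameters is below e/2, both are below e, and both points are
      close to the apex of CX, whatever x and y are.  Otherwise 2ts is bounded
      away from 0, so 1 - cos d(x,y), and with it d(x,y), must be small
      ([euclidean_to_cone_unif_continuous]).  *)

(** * The angle and its versed sine *)

Section versed_sine.
Context {R : realType}.
Implicit Types a c e : R.

(** As cos decreases on [0,pi], the modulus is c = acos (1 - e); capping e at 1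
    keeps 1 - e in the domain of acos. *)
Lemma one_minus_cos_small e : 0 < e ->
  exists2 c, 0 < c & forall a, 0 <= a <= pi -> a < c -> 1 - cos a < e.
Proof.
move=> e0; pose e' := Num.min e 1.
have e'0 : 0 < e' by rewrite lt_min e0 ltr01.
have e'e : e' <= e by rewrite ge_min lexx.
have e'1 : e' <= 1 by rewrite ge_min lexx orbT.
have dom : -1 <= 1 - e' <= 1 by apply/andP; split; lra.
exists (acos (1 - e')); first by apply: acos_gt0; apply/andP; split; lra.
move=> a apos alt.
suff : 1 - e' < cos a by lra.
rewrite -[X in X < _](@acosK R); last by rewrite in_itv.
by rewrite ltr_cos// in_itv/= ?acos_ge0 ?acos_lepi.
Qed.

(** This is where the bound pi on the distances enters: without it, 1 - cos a
    is also small near a = 2pi.  The modulus is 1 - cos e, with e capped at pi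
    to stay where cos is decreasing. *)
Lemma angle_small e : 0 < e ->
  exists2 c, 0 < c & forall a, 0 <= a <= pi -> 1 - cos a < c -> a < e.
Proof.
move=> e0; have p0 := pi_gt0 R.
pose e' : R := Num.min e pi.
have e'0 : 0 < e' by rewrite lt_min e0 p0.
have e'e : e' <= e by rewrite ge_min lexx.
have e'pi : e' <= pi by rewrite ge_min lexx orbT.
have dom : e' \in `[0, pi] by rewrite in_itv/= e'pi ltW.
exists (1 - cos e').
  rewrite subr_gt0 -cos0 ltr_cos//.
  by rewrite in_itv/= lexx ltW.
move=> a adom; rewrite ltrD2l ltrN2 ltr_cos// => ae'.
exact: lt_le_trans ae' e'e.
Qed.

End versed_sine.

(** * Reversing the cone parameter *)

Section reversal.
Context {R : realType}.

Lemma in_unit_itv (r : R) : (r \in unit_itv R) = (0 <= r <= 1).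
Proof. by apply/idP/idP; rewrite inE /unit_itv /= in_itv. Qed.

Lemma unit_itv_bounds (t : unit_itv R) : 0 <= val t <= 1.
Proof. by rewrite -in_unit_itv; exact: valP. Qed.

Lemma unit_itv_rev_subproof (t : unit_itv R) : 1 - val t \in unit_itv R.
Proof.
have /andP[t0 t1] := unit_itv_bounds t.
by rewrite in_unit_itv; apply/andP; split; lra.
Qed.

Definition unit_itv_rev (t : unit_itv R) : unit_itv R :=
  exist _ (1 - val t) (unit_itv_rev_subproof t).

Lemma val_unit_itv_rev t : val (unit_itv_rev t) = 1 - val t.
Proof. by []. Qed.

Lemma unit_itv_revK : involutive unit_itv_rev.
Proof. by move=> t; apply: val_inj; rewrite !val_unit_itv_rev subKr. Qed.

Lemma unit_itv_rev0 : unit_itv_rev unit_itv0 = unit_itv1.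
Proof. by apply: val_inj; exact: subr0. Qed.

Lemma unit_itv_rev1 : unit_itv_rev unit_itv1 = unit_itv0.
Proof. by apply: val_inj; exact: subrr. Qed.

Lemma ball_mdist (M : metricType R) (p q : M) (e : R) :
  ball p e q = (mdist p q < e) :> Prop.
Proof. by rewrite ballEmdist. Qed.

Lemma ball_unit_itv_prod (M : metricType R) (x y : M) (t s : unit_itv R)
    (e : R) :
  ball (x, t) e (y, s) <-> mdist x y < e /\ `|val t - val s| < e.
Proof. by rewrite -ball_mdist. Qed.

(** The parameter t of the Euclidean cone being small, (x,1-t) is close to the
    level that CX collapses, along the segment over x. *)
Lemma ball_unit_itv_rev1 (M : metricType R) (x : M) (t : unit_itv R) (e : R) :
  val t < e -> ball (x, unit_itv_rev t) e (x, unit_itv1).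
Proof.
have /andP[t0 _] := unit_itv_bounds t.
move=> te; apply/ball_unit_itv_prod; rewrite mdistxx val_unit_itv_rev.
split; first exact: le_lt_trans te.
by rewrite [val unit_itv1]/(1 : R) addrAC subrr sub0r normrN ger0_norm.
Qed.

End reversal.

(** * The homeomorphism *)

Section euclidean_cone_cone.
Variables (R : realType) (X : metricType R).
Variable diamX : forall x y : X, mdist x y <= pi.

Local Notation E := (euclidean_cone diamX).
Local Notation C := (cone R X).

(** Separates the radial part of the distance from the angular part, both of
    them nonnegative. *)
Lemma mdist_euclidean_cone_versed (x y : X) (t s : unit_itv R) :
  mdist (\pi_E (x, t)) (\pi_E (y, s)) ^+ 2 =
  (val t - val s) ^+ 2 + 2 * val t * val s * (1 - cos (mdist x y)).
Proof. by rewrite mdist_euclidean_coneE; ring. Qed.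

Definition euclidean_to_cone (p : E) : C :=
  \pi_C ((repr p).1, unit_itv_rev (repr p).2).

Definition cone_to_euclidean (p : C) : E :=
  \pi_E ((repr p).1, unit_itv_rev (repr p).2).

Lemma euclidean_to_cone_pi x t :
  euclidean_to_cone (\pi_E (x, t)) = \pi_C (x, unit_itv_rev t).
Proof.
have /collapseP := reprK (\pi_E (x, t)); rewrite /euclidean_to_cone.
case: (repr _) => y s /= [[-> ->]//|[-> ->]]; apply/collapseP; right.
by rewrite unit_itv_rev0.
Qed.

Lemma cone_to_euclidean_pi x t :
  cone_to_euclidean (\pi_C (x, t)) = \pi_E (x, unit_itv_rev t).
Proof.
have /collapseP := reprK (\pi_C (x, t)); rewrite /cone_to_euclidean.
case: (repr _) => y s /= [[-> ->]//|[-> ->]]; apply/collapseP; right.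
by rewrite unit_itv_rev1.
Qed.

Lemma euclidean_to_coneK : cancel euclidean_to_cone cone_to_euclidean.
Proof.
move=> p; rewrite -[p]reprK; case: (repr p) => x t.
by rewrite euclidean_to_cone_pi cone_to_euclidean_pi unit_itv_revK.
Qed.

Lemma cone_to_euclideanK : cancel cone_to_euclidean euclidean_to_cone.
Proof.
move=> p; rewrite -[p]reprK; case: (repr p) => x t.
by rewrite cone_to_euclidean_pi euclidean_to_cone_pi unit_itv_revK.
Qed.

(** Each of the two terms (t - s)^2 and 2ts(1 - cos d(x,y)) is kept below
    a fraction of e^2, the second one through ts <= 1. *)
Lemma cone_to_euclidean_unif_continuous : unif_continuous cone_to_euclidean.
Proof.
apply: quotient_unif_continuous; apply/unif_continuousP => e e0.
have [c c0 cP] := one_minus_cos_small (e ^+ 2 / 4) ltac:(nra).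
exists (Num.min c (e / 2)) => /=; first by rewrite lt_min c0/= divr_gt0.
move=> [[x t] [y s]] /ball_unit_itv_prod[].
rewrite !lt_min => /andP[xy _] /andP[_ ts].
rewrite [X in ball X]cone_to_euclidean_pi [X in ball _ _ X]cone_to_euclidean_pi.
rewrite ball_mdist.
rewrite -(@ltr_pXn2r _ 2)// ?nnegrE ?mdist_ge0 ?ltW//.
rewrite mdist_euclidean_cone_versed !val_unit_itv_rev.
have := cP _ _ xy; rewrite mdist_ge0 diamX => /(_ isT) cos_xy.
have cos1 := cos_le1 (mdist x y).
have /andP[t0 t1] := unit_itv_bounds t.
have /andP[s0 s1] := unit_itv_bounds s.
have ts2 : (val t - val s) ^+ 2 < (e / 2) ^+ 2.
  by rewrite -real_normK ?num_real// ltr_pXn2r ?nnegrE// divr_ge0// ltW.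
have st1 : (1 - val t) * (1 - val s) <= 1 by nra.
have : (1 - val t) * (1 - val s) * (1 - cos (mdist x y)) <=
    1 - cos (mdist x y) by nra.
nra.
Qed.

(** The entourage is used at its half V: near the apex the chain between the two
    image points has two steps, as it passes through the apex. *)
Lemma euclidean_to_cone_unif_continuous : unif_continuous euclidean_to_cone.
Proof.
move=> W /entourage_split_ex[V entV VW].
have := @pi_unif_continuous _ _ _ entV.
rewrite /nbhs/= -!entourage_ballE => -[/= e e0 eV].
have [c c0 cP] := angle_small e e0.
(* d <= e/2 controls the parameters; d <= 1 and d <= (e^2/2) c give
   d^2 <= (e^2/2) c, which controls the angle away from the apex *)
pose d : R := Num.min (e / 2) (Num.min 1 (e ^+ 2 / 2 * c)).
have ec0 : 0 < e ^+ 2 / 2 * c by rewrite mulr_gt0 ?divr_gt0 ?exprn_gt0.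
have d0 : 0 < d by rewrite !lt_min divr_gt0//= ltr01.
exists d => //= -[p q]; rewrite -[p]reprK -[q]reprK.
case: (repr p) => x t; case: (repr q) => y s.
change (ball (\pi_E (x, t)) d (\pi_E (y, s)) ->
  W (euclidean_to_cone (\pi_E (x, t)), euclidean_to_cone (\pi_E (y, s)))).
rewrite ball_mdist.
rewrite -(@ltr_pXn2r _ 2)// ?nnegrE ?mdist_ge0 ?ltW//.
rewrite mdist_euclidean_cone_versed !euclidean_to_cone_pi => dist_d.
have /andP[t0 t1] := unit_itv_bounds t.
have /andP[s0 s1] := unit_itv_bounds s.
have cos1 := cos_le1 (mdist x y).
have de : d <= e / 2 by rewrite ge_min lexx.
have d1 : d <= 1 by rewrite !ge_min lexx orbT.
have dc : d <= e ^+ 2 / 2 * c by rewrite !ge_min lexx !orbT.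
have radial0 : 0 <= 2 * val t * val s * (1 - cos (mdist x y)).
  by rewrite !mulr_ge0// subr_ge0.
have ts : `|val t - val s| < e / 2.
  apply: lt_le_trans de.
  rewrite -(@ltr_pXn2r _ 2)// ?nnegrE ?ltW// real_normK ?num_real//; lra.
have [ts_le|ts_gt] := leP (Num.min (val t) (val s)) (e / 2).
  (* near the apex, x and y can be far apart: connect each of the two points to
     the apex along its own ray *)
  have [te se] : val t < e /\ val s < e.
    by move: ts_le; rewrite ge_min => /orP[] ?; split; move: ts;
      rewrite ltr_norml => /andP[]; lra.
  apply: VW; exists (\pi_C (x, unit_itv1)).
    exact/(eV ((x, unit_itv_rev t), (x, unit_itv1)))/ball_unit_itv_rev1.
  have -> : \pi_C (x, unit_itv1) = \pi_C (y, unit_itv1).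
    by apply/collapseP; right.
  exact/(eV ((y, unit_itv1), (y, unit_itv_rev s)))/ball_sym/ball_unit_itv_rev1.
(* away from the apex 2ts > e^2/2, so the bound on the angular part of the
   distance bounds 1 - cos d(x,y) by c *)
move: ts_gt; rewrite lt_min => /andP[te se].
apply: VW.
exists (\pi_C (y, unit_itv_rev s)); last exact: entourage_refl.
apply: (eV ((x, unit_itv_rev t), (y, unit_itv_rev s))).
apply/ball_unit_itv_prod; split.
  apply: cP; first by rewrite mdist_ge0 diamX.
  have ets : e ^+ 2 / 4 <= val t * val s by nra.
  rewrite -(@ltr_pM2l _ (e ^+ 2 / 2)); last by rewrite divr_gt0 ?exprn_gt0.
  have d2 : d ^+ 2 <= d by rewrite expr2 ger_pMl.
  have dts := sqr_ge0 (val t - val s).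
  have : e ^+ 2 / 2 * (1 - cos (mdist x y)) <=
      2 * val t * val s * (1 - cos (mdist x y)).
    by apply: ler_wpM2r; [rewrite subr_ge0|lra].
  lra.
rewrite !val_unit_itv_rev.
have -> : 1 - val t - (1 - val s) = - (val t - val s) by ring.
by rewrite normrN; lra.
Qed.

End euclidean_cone_cone.

Theorem lemma11p2 (R : realType) (X : metricType R)
    (diamX : forall x y : X, mdist x y <= pi) :
  exists2 h : euclidean_cone diamX -> cone R X,
    unif_homeomorphism h &
    forall x : X, h (\pi_(euclidean_cone diamX) (x, unit_itv1)) =
                  \pi_(cone R X) (x, unit_itv0).
Proof.
exists (@euclidean_to_cone R X diamX).
  exists (@cone_to_euclidean R X diamX); split.
  - exact: euclidean_to_coneK.
  - exact: cone_to_euclideanK.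
  - exact: euclidean_to_cone_unif_continuous.
  - exact: cone_to_euclidean_unif_continuous.
by move=> x; rewrite euclidean_to_cone_pi unit_itv_rev1.
Qed.
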